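(* Let $\Bbbk$ be a field with $\operatorname{char}(\Bbbk)=2$ and let $G$ be a connected finite simple undirected graph. The parity binomial edge ideal \[ \mathcal{I}_G=\langle x_ix_j-y_iy_j : \{i,j\}\in E(G)\rangle\subseteq \Bbbk[x_i,y_i : i\in V(G)] \] is radical if and only if $G$ is bipartite.
   Context: $V(G)$ and $E(G)$ denote the vertex set and edge set of $G$. Graphs are finite and simple. The ideal $\mathcal{I}_G$ displayed in the claim is called the parity binomial edge ideal of $G$. *)

(* Defs.v *)
From HB Require Import structures.
From mathcomp Require Import all_boot all_order all_algebra.
From mathcomp Require Import mpoly.

Set Implicit Arguments.
Unset Strict Implicit.
Unset Printing Implicit Defensive.

Import GRing.Theory.
Local Open Scope ring_scope.

Record sgraph := SGraph {
  vertex :> finType;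
  edge : rel vertex;
  edge_sym : ssrbool.symmetric edge;
  edge_irrefl : irreflexive edge }.

(* The graph without vertices is connected in this sense. *)
Definition connected_graph (G : sgraph) : Prop :=
  forall u v : G, connect (@edge G) u v.

Definition bipartite (G : sgraph) : Prop :=
  exists A : {set G}, forall u v : G, edge u v -> (u \in A) != (v \in A).

(* Ideals are Prop-valued sets here: the ideal classes of ring_quotient are
   boolean, and would need membership in a generated ideal to be decided. *)
Definition ideal_gen (R : comNzRingType) (S : R -> Prop) (f : R) : Prop :=
  exists2 s : seq (R * R),
    (forall p, p \in s -> S p.2) & f = \sum_(p <- s) p.1 * p.2.

Definition radical_ideal (R : comNzRingType) (I : R -> Prop) : Prop :=
  forall (f : R) (n : nat), I (f ^+ n) -> I f.

Section ParityBinomialEdgeIdeal.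
Variables (k : fieldType) (G : sgraph).

(* Indexing the indeterminates by the enumeration of the vertices, the first
   #|G| of them are the x_v and the last #|G| are the y_v. *)
Definition xvar (v : G) : {mpoly k[#|G| + #|G|]} :=
  'X_(lshift #|G| (enum_rank v)).

Definition yvar (v : G) : {mpoly k[#|G| + #|G|]} :=
  'X_(rshift #|G| (enum_rank v)).

Definition parity_edge_binomial (f : {mpoly k[#|G| + #|G|]}) : Prop :=
  exists u v : G, edge u v /\ f = xvar u * xvar v - yvar u * yvar v.

Definition parity_binomial_edge_ideal : {mpoly k[#|G| + #|G|]} -> Prop :=
  ideal_gen parity_edge_binomial.

End ParityBinomialEdgeIdeal.

Arguments parity_binomial_edge_ideal : clear implicits.

(* Main.v *)
Require Import Defs.
From HB Require Import structures.
From mathcomp Require Import all_boot all_order all_algebra.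
From mathcomp Require Import ring.
From mathcomp Require Import mpoly.

Import GRing.Theory.
Local Open Scope ring_scope.

(** Suppose first that G is bipartite with a part A. Exchanging x_v and y_v for
    every v outside A turns x_u x_w - y_u y_w, up to sign, into the 2-minor
    x_u y_w - y_u x_w, so the ideal becomes the binomial edge ideal J_G. Such
    ideals are radical over every field and for every graph
    ([radical_edge_ideal]). The proof is an induction on the number of vertices
    whose neighbourhood is not a clique. For such a vertex v, let G_v be G with
    the neighbourhood of v completed to a clique. Then
      J_G = J_(G_v) n ((x_v, y_v) + J_(G - v)),
    and both graphs on the right have fewer vertices of that kind, since v
    itself is no longer one ([radical_split]). The nontrivial inclusion rests
    on the fact that x_v and y_v multiply each minor on two neighbours of v
    into J_G ([sub_kill_minor]). When no such vertex is left, every component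
    is complete and J_G is the kernel of a monomial parametrization with values
    in a domain ([ker_param]), hence prime.

    Conversely, let G be connected and not bipartite. Adding up the edge
    relations along a closed odd walk at v gives g (x_v^2 - y_v^2) in I_G, where
    g does not vanish at the point with all coordinates 1 ([odd_walk_local]).
    In characteristic 2 this is g (x_v - y_v)^2, so g (x_v - y_v) has its square
    in I_G. It is not in I_G itself: the substitution x_w = 1 + t, y_w = 1
    sends the edge binomials to (1 + t)^2 - 1 = t^2, and it sends
    g (x_v - y_v) to t times a unit at t = 0
    ([radical_no_odd_walk]). *)

(** * Ideals generated by a set *)

Section GeneratedIdeals.
Set Implicit Arguments.
Unset Strict Implicit.
Variable R : comNzRingType.
Implicit Types (S T : R -> Prop) (f g : R).

Lemma ideal_gen0 S : ideal_gen S 0.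
Proof. by exists [::] => //; rewrite big_nil. Qed.

Lemma ideal_genD S f g : ideal_gen S f -> ideal_gen S g -> ideal_gen S (f + g).
Proof.
move=> [s sS ->] [t tS ->]; exists (s ++ t); last by rewrite big_cat.
by move=> p; rewrite mem_cat => /orP[/sS|/tS].
Qed.

Lemma ideal_genMl S a f : ideal_gen S f -> ideal_gen S (a * f).
Proof.
move=> [s sS ->]; exists [seq (a * p.1, p.2) | p <- s].
  by move=> _ /mapP[p ps ->]; exact: (sS p).
by rewrite big_map mulr_sumr; apply: eq_bigr => p _; rewrite mulrA.
Qed.

Lemma ideal_genN S f : ideal_gen S f -> ideal_gen S (- f).
Proof. by rewrite -mulN1r; apply: ideal_genMl. Qed.

Lemma ideal_genB S f g : ideal_gen S f -> ideal_gen S g -> ideal_gen S (f - g).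
Proof. by move=> Sf /ideal_genN; apply: ideal_genD. Qed.

Lemma ideal_gen_base S f : S f -> ideal_gen S f.
Proof.
move=> Sf; exists [:: (1, f)]; last by rewrite big_seq1 mul1r.
by move=> p; rewrite inE => /eqP ->.
Qed.

Lemma ideal_gen_sum S (I : Type) (r : seq I) (P : pred I) (F : I -> R) :
  (forall i, P i -> ideal_gen S (F i)) -> ideal_gen S (\sum_(i <- r | P i) F i).
Proof.
by move=> SF; apply: big_ind => //; [apply: ideal_gen0 | apply: ideal_genD].
Qed.

Lemma ideal_gen_ind S (P : R -> Prop) :
  P 0 -> (forall f g, P f -> P g -> P (f + g)) ->
  (forall a s, S s -> P (a * s)) -> forall f, ideal_gen S f -> P f.
Proof.
move=> P0 PD PM f [s sS ->]; rewrite big_seq.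
by apply: big_ind => // p /sS; apply: PM.
Qed.

Lemma ideal_gen_sub S T f :
  (forall s, S s -> ideal_gen T s) -> ideal_gen S f -> ideal_gen T f.
Proof.
move=> ST; apply: ideal_gen_ind => [||a s /ST].
- exact: ideal_gen0.
- exact: ideal_genD.
- exact: ideal_genMl.
Qed.

End GeneratedIdeals.

Lemma ideal_gen_morph (R R' : comNzRingType) (h : {rmorphism R -> R'})
    (S : R -> Prop) (T : R' -> Prop) (f : R) :
  (forall s, S s -> ideal_gen T (h s)) -> ideal_gen S f -> ideal_gen T (h f).
Proof.
move=> ST; apply: (@ideal_gen_ind _ S (fun f => ideal_gen T (h f))).
- by rewrite rmorph0; apply: ideal_gen0.
- by move=> g g'; rewrite rmorphD; apply: ideal_genD.
- by move=> a s /ST; rewrite rmorphM; apply: ideal_genMl.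
Qed.

Lemma mpoly_subalg_ind (n : nat) (k : nzRingType) (P : {mpoly k[n]} -> Prop) :
  (forall c, P c%:MP) -> (forall i, P 'X_i) ->
  (forall p q, P p -> P q -> P (p + q)) ->
  (forall p q, P p -> P q -> P (p * q)) -> forall p, P p.
Proof.
move=> PC PX PD PM; apply: mpolyind => [|c m p _ _ Pp]; first by rewrite -mpolyC0.
apply: PD => //; rewrite -mul_mpolyC; apply: (PM) => //.
rewrite mpolyXE_id; apply: big_ind => // [|i _]; first by rewrite -mpolyC1.
by elim: (m i) => [|d IHd]; rewrite ?expr0 -?mpolyC1 // exprS; apply: PM.
Qed.

(** * Binomial edge ideals *)

Section BinomialEdgeIdeals.
Set Implicit Arguments.
Unset Strict Implicit.
Variables (k : fieldType) (N : nat) (V : finType).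
(** The labelling of the variables is an arbitrary bijection, so that the
    exchange of x_v and y_v for some of the v is a change of [idx] only. *)
Variables (idx : V * bool -> 'I_N) (own : 'I_N -> V * bool).
Hypotheses (idxK : cancel idx own) (ownK : cancel own idx).
Local Notation R := {mpoly k[N]}.
Implicit Types (e : rel V) (f g h : R) (m : 'X_{1..N}).

Local Notation xi v := (idx (v, true)).
Local Notation yi v := (idx (v, false)).
Let x v : R := 'X_(xi v).
Let y v : R := 'X_(yi v).

Lemma idx_eq p q : (idx p == idx q) = (p == q).
Proof. exact: (inj_eq (can_inj idxK)). Qed.

Definition minor (u w : V) : R := x u * y w - y u * x w.

Definition edge_minor e f : Prop := exists u w, e u w /\ f = minor u w.

Local Notation J e := (ideal_gen (edge_minor e)).

Lemma minor_in e u w : e u w -> J e (minor u w).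
Proof. by move=> euw; apply: ideal_gen_base; exists u, w. Qed.

Lemma edge_ideal_mono e e' f : subrel e e' -> J e f -> J e' f.
Proof.
by move=> le; apply: ideal_gen_sub => _ [u [w [/le euw ->]]]; apply: minor_in.
Qed.

(** The substitution x_v = y_v = 0. *)
Definition kill v : R -> R :=
  comp_mpoly [tuple if (own i).1 == v then 0 else 'X_i | i < N].

HB.instance Definition _ v := GRing.RMorphism.on (kill v).

Lemma killX v i : kill v 'X_i = if (own i).1 == v then 0 else 'X_i.
Proof. by rewrite /kill comp_mpolyXU -tnth_nth tnth_mktuple. Qed.

Lemma killC v c : kill v c%:MP = c%:MP.
Proof. exact: comp_mpolyC. Qed.

Lemma kill_minor v u w :
  kill v (minor u w) = if (u == v) || (w == v) then 0 else minor u w.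
Proof.
rewrite /minor rmorphB !rmorphM /= !killX !idxK /=.
by case: (u == v); case: (w == v); rewrite ?mulr0 ?mul0r ?subrr.
Qed.

(** Vertex relations are taken reflexive, which adds only zero minors to the
    ideal and makes e v the closed neighbourhood of v. The deleted vertex stays
    as an isolated one, which keeps the polynomial ring unchanged. *)
Definition delete v e : rel V :=
  fun u w => (u == w) || [&& e u w, u != v & w != v].

Definition complete v e : rel V := fun u w => e u w || (e v u && e v w).

Definition simplicial e v := [forall u, forall w, e v u ==> e v w ==> e u w].

Lemma simplicialP e v :
  reflect (forall u w, e v u -> e v w -> e u w) (simplicial e v).
Proof.
apply: (iffP forallP) => [H u w vu vw | H u].
  by have /forallP/(_ w) := H u; rewrite vu vw.
by apply/forallP => w; apply/implyP => vu; apply/implyP; apply: H.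
Qed.

Definition radical e := forall f n, J e (f ^+ n) -> J e f.

(** * Splitting at a vertex *)

Section Split.
Variables (e : rel V) (v : V).
Hypotheses (e_refl : reflexive e) (e_sym : ssrbool.symmetric e).

Lemma kill_edge_ideal f : J e f -> J (delete v e) (kill v f).
Proof.
apply: ideal_gen_morph => _ [u [w [uw ->]]] /=; rewrite kill_minor.
have [_|/norP[uv wv]] := boolP (_ || _); first exact: ideal_gen0.
by apply: minor_in; rewrite /delete uw uv wv orbT.
Qed.

(** The ideal (x_v, y_v) multiplies the minor on two neighbours u, w of v into
    the ideal: by the Pluecker-type relation
      x_v [u w] = x_u [v w] + x_w [u v]
    and the same one with y in place of the coefficients x. The h for
    which the claim holds form a subalgebra, so it is enough to treat the
    variables. *)
Lemma sub_kill_minor u w h :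
  e v u -> e v w -> J e ((h - kill v h) * minor u w).
Proof.
move=> vu vw; move: h; apply: mpoly_subalg_ind => [c|i|f g Jf Jg|f g Jf Jg].
- by rewrite killC subrr mul0r; apply: ideal_gen0.
- rewrite killX; case: eqP => [iv|_]; last by rewrite subrr mul0r; apply: ideal_gen0.
  have Jvw := minor_in vw; have Juv : J e (minor u v) by apply: minor_in; rewrite e_sym.
  rewrite -(ownK i) subr0; case: (own i) iv => [_ b] /= ->.
  case: b.
    rewrite (_ : _ * _ = x u * minor v w + x w * minor u v).
      by apply: ideal_genD; apply: ideal_genMl.
    by rewrite /minor /x /y; ring.
  rewrite (_ : _ * _ = y u * minor v w + y w * minor u v).
    by apply: ideal_genD; apply: ideal_genMl.
  by rewrite /minor /x /y; ring.
- rewrite (_ : _ * _ = (f - kill v f) * minor u w + (g - kill v g) * minor u w).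
    exact: ideal_genD.
  by rewrite rmorphD; ring.
- rewrite (_ : _ * _ = f * ((g - kill v g) * minor u w)
                       + kill v g * ((f - kill v f) * minor u w)).
    by apply: ideal_genD; apply: ideal_genMl.
  by rewrite rmorphM; ring.
Qed.

Lemma delete_sub f : J (delete v e) f -> J e f.
Proof.
by apply: edge_ideal_mono => u w /orP[/eqP-> | /and3P[]] //; rewrite e_refl.
Qed.

(** An element of the ideal of the completed graph is determined modulo J e by
    its value at x_v = y_v = 0, because the minors that completion adds are on
    two neighbours of v. *)
Lemma sub_kill_complete f : J (complete v e) f -> J e (f - kill v f).
Proof.
move: f; apply: ideal_gen_ind.
- by rewrite rmorph0 subr0; apply: ideal_gen0.
- move=> f g Jf Jg; rewrite rmorphD opprD addrACA; exact: ideal_genD.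
move=> h _ [u [w [/orP[uw|/andP[vu vw]] ->]]].
  have Juw := minor_in uw; apply: ideal_genB; first exact: ideal_genMl.
  by rewrite rmorphM; apply: ideal_genMl; apply: delete_sub; apply: kill_edge_ideal.
rewrite rmorphM /= kill_minor.
have [->|uv] := eqVneq u v; first by rewrite mulr0 subr0; apply/ideal_genMl/minor_in.
have [->|wv] := eqVneq w v; last by rewrite -mulrBl; apply: sub_kill_minor.
by rewrite mulr0 subr0; apply/ideal_genMl/minor_in; rewrite e_sym.
Qed.

(** If f^n is in J e, then f - kill v f and kill v f both are in J e, by
    radicality for the completed graph and for the deleted graph. *)
Lemma radical_split : radical (delete v e) -> radical (complete v e) -> radical e.
Proof.
move=> rad_del rad_compl f n Jfn; rewrite -(subrK (kill v f) f).
apply: ideal_genD; last first.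
  by apply/delete_sub/(rad_del _ n); rewrite -rmorphXn; apply: kill_edge_ideal.
apply/sub_kill_complete/(rad_compl _ n).
by apply: edge_ideal_mono Jfn => u w uw; rewrite /complete uw.
Qed.

Lemma delete_refl : reflexive (delete v e).
Proof. by move=> u; rewrite /delete eqxx. Qed.

Lemma delete_sym : ssrbool.symmetric (delete v e).
Proof. by move=> u w; rewrite /delete eq_sym e_sym (andbC (u != v)). Qed.

Lemma complete_refl : reflexive (complete v e).
Proof. by move=> u; rewrite /complete e_refl. Qed.

Lemma complete_sym : ssrbool.symmetric (complete v e).
Proof. by move=> u w; rewrite /complete e_sym andbC. Qed.

(** This and the next lemma make the induction on the number of non-simplicial
    vertices decrease, as long as v is not simplicial in e. *)
Lemma simplicial_delete w : (w == v) || simplicial e w -> simplicial (delete v e) w.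
Proof.
move=> vw; apply/simplicialP => a b /orP[/eqP <- //|/and3P[wa wv av]].
case/orP=> [/eqP <-|/and3P[wb _ bv]]; first by rewrite /delete e_sym wa wv av orbT.
move: vw; rewrite (negPf wv) => /simplicialP sw.
by rewrite /delete av bv (sw a b) ?orbT.
Qed.

Lemma simplicial_complete w :
  (w == v) || simplicial e w -> simplicial (complete v e) w.
Proof.
move=> vw; apply/simplicialP.
have [wv|wv] := eqVneq w v.
  have E a : complete v e w a -> e v a by rewrite wv => /orP[//|/andP[]].
  by move=> a b /E va /E vb; rewrite /complete va vb orbT.
move: vw; rewrite (negPf wv) => /simplicialP sw.
have [vw a b|nvw a b] := boolP (e v w).
  have E c : complete v e w c -> e v c.
    by case/orP=> [wc|/andP[//]]; apply: sw; rewrite // e_sym.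
  by move=> /E va /E vb; rewrite /complete va vb orbT.
by rewrite /complete (negPf nvw) !orbF => wa wb; rewrite (sw a b).
Qed.

End Split.

(** * Graphs with complete components *)

Section CompleteComponents.
Variable e : rel V.
Hypotheses (e_refl : reflexive e) (e_sym : ssrbool.symmetric e).
Hypothesis e_trans : ssrbool.transitive e.

(** The exponent of the image of the monomial m under the parametrization
      x_v |-> y_v * prod_(w ~ v) x_w,   y_v |-> y_v.
    It records the degree of m in {x_v, y_v} for each vertex v, and the degree
    in all the x_u of each component. *)
Definition wt m : 'X_{1..N} :=
  [multinom (let: (w, b) := own j in
             if b then (\sum_(u | e u w) m (xi u))%N else (m (xi w) + m (yi w))%N)
  | j < N].

Lemma wt_x m w : wt m (xi w) = (\sum_(u | e u w) m (xi u))%N.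
Proof. by rewrite mnmE idxK. Qed.

Lemma wt_y m w : wt m (yi w) = (m (xi w) + m (yi w))%N.
Proof. by rewrite mnmE idxK. Qed.

Lemma eq_mnm_idx m m' : (forall v b, m (idx (v, b)) = m' (idx (v, b))) -> m = m'.
Proof. by move=> E; apply/mnmP => j; rewrite -(ownK j); case: (own j). Qed.

Lemma wt0 : wt 0%MM = 0%MM.
Proof.
apply: eq_mnm_idx => w [|]; rewrite ?wt_x ?wt_y !mnm0E //.
by rewrite big1 // => u _; rewrite mnm0E.
Qed.

Lemma wtD : {morph wt : m m' / (m + m')%MM}.
Proof.
move=> m m'; apply: eq_mnm_idx => w [|]; rewrite mnmDE ?wt_x ?wt_y.
  by rewrite -big_split; apply: eq_bigr => u _; rewrite mnmDE.
by rewrite !mnmDE addnACA.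
Qed.

Lemma wtMn m d : wt (m *+ d)%MM = (wt m *+ d)%MM.
Proof.
elim: d => [|d IHd]; first by rewrite !mulm0n wt0.
by rewrite !mulmS wtD IHd.
Qed.

Definition param : R -> R := comp_mpoly [tuple 'X_[wt U_(i)] | i < N].

HB.instance Definition _ := GRing.RMorphism.on param.

Lemma paramX m : param 'X_[m] = 'X_[wt m].
Proof.
rewrite /param comp_mpolyX.
under eq_bigr do rewrite tnth_mktuple.
rewrite mprodXnE {2}(multinomUE_id m) (big_morph wt wtD wt0).
by congr 'X_[_]; apply: eq_bigr => i _; rewrite wtMn.
Qed.

Lemma wt_swap u w : e u w -> wt (U_(xi u) + U_(yi w))%MM = wt (U_(yi u) + U_(xi w))%MM.
Proof.
move=> uw; apply: eq_mnm_idx => z [|]; rewrite ?wt_x ?wt_y; last first.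
  rewrite !mnmDE !mnm1E !idx_eq /= !xpair_eqE ?andbT ?andbF.
  by rewrite addnC.
have E v c : (\sum_(t | e t z) (U_(xi v) + U_(yi c))%MM (xi t))%N = e v z.
  rewrite (eq_bigr (fun t => nat_of_bool (v == t))) => [|t _]; last first.
    by rewrite mnmDE !mnm1E !idx_eq /= !xpair_eqE andbT andbF /= addn0.
  rewrite big_mkcond (bigD1 v) //= eqxx big1 ?addn0; first by case: (e v z).
  by move=> t /negPf; rewrite eq_sym => ->; case: (e t z).
rewrite E addmC E; congr nat_of_bool; apply/idP/idP => [uz|]; last exact: e_trans.
by apply: e_trans uz; rewrite e_sym.
Qed.

Lemma param_edge_ideal f : J e f -> param f = 0.
Proof.
move: f; apply: ideal_gen_ind => [|f g f0 g0|h _ [u [w [uw ->]]]].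
- exact: rmorph0.
- by rewrite rmorphD /= f0 g0 addr0.
by rewrite rmorphM rmorphB /= /x /y -!mpolyXD !paramX (wt_swap uw) subrr mulr0.
Qed.

(** Both monomials have the same total x-degree on the component of u. *)
Lemma wt_balance m m' u : wt m = wt m' -> (m' (xi u) < m (xi u))%N ->
  exists2 w, e u w & (m (xi w) < m' (xi w))%N.
Proof.
move=> Ewt lt_u.
have [/existsP[w /andP[]]|] := boolP [exists w, e u w && (m (xi w) < m' (xi w))%N].
  by exists w.
rewrite negb_exists => /forallP ge.
have /eqP := congr1 (fun p : 'X_{1..N} => p (xi u)) Ewt; rewrite !wt_x gtn_eqF //.
rewrite (bigD1 u) // [X in (_ < X)%N](bigD1 u) //= -addSn leq_add //.
apply: leq_sum => t /andP[tu _]; have := ge t.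
by rewrite e_sym tu /= -leqNgt.
Qed.

(** The fibres of the parametrization are connected by edge moves. If m has a
    larger x_u-degree than m', then it has a smaller x_w-degree for some w in
    the same component, and it is then divisible by x_u y_w; the move to
    y_u x_w brings it closer to m'. *)
Lemma wt_fiber m m' : wt m = wt m' -> J e ('X_[m] - 'X_[m']).
Proof.
have [d] := ubnP (\sum_u (m (xi u) - m' (xi u)))%N.
elim: d => // d IHd in m *; rewrite ltnS => le_d Ewt.
have [/existsP[u lt_u]|] := boolP [exists u, (m' (xi u) < m (xi u))%N]; last first.
  rewrite negb_exists => /forallP le.
  have Ex u : m (xi u) = m' (xi u).
    apply/eqP; rewrite eqn_leq leqNgt le leqNgt; apply/negP => lt_u.
    by have [w _] := wt_balance (esym Ewt) lt_u; apply/negP/le.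
  suff -> : m = m' by rewrite subrr; apply: ideal_gen0.
  apply: eq_mnm_idx => u [|] //.
  have := congr1 (fun p : 'X_{1..N} => p (yi u)) Ewt.
  by rewrite !wt_y Ex => /addnI.
have [w uw lt_w] := wt_balance Ewt lt_u.
have uNw : (u == w) = false by apply/negbTE/eqP => E; move: lt_w; rewrite -E ltnNge ltnW.
have y_w : (0 < m (yi w))%N.
  have := congr1 (fun p : 'X_{1..N} => p (yi w)) Ewt; rewrite !wt_y.
  case: (m (yi w)) => // /eqP; rewrite addn0 ltn_eqF //.
  exact: leq_trans lt_w (leq_addr _ _).
pose r := (m - (U_(xi u) + U_(yi w)))%MM.
have Em : m = (r + (U_(xi u) + U_(yi w)))%MM.
  rewrite submK //; apply/mnm_lepP => j; rewrite mnmDE !mnm1E.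
  have [<-|_] := eqVneq (xi u) j; first by rewrite idx_eq xpair_eqE andbF /= addn0 (leq_trans _ lt_u).
  by have [<-|//] := eqVneq (yi w) j.
pose m2 := (r + (U_(yi u) + U_(xi w)))%MM.
rewrite -(subrK 'X_[m2] 'X_[m]) -addrA; apply: ideal_genD.
  rewrite Em !mpolyXD -mulrBr; apply: ideal_genMl; exact: minor_in.
apply: IHd; last by rewrite -Ewt Em /m2 !(wtD r) (wt_swap uw).
have m2E t : m2 (xi t) = (r (xi t) + (w == t))%N.
  by rewrite !mnmDE !mnm1E !idx_eq !xpair_eqE andbT andbF.
have mE t : m (xi t) = (r (xi t) + (u == t))%N.
  by rewrite Em !mnmDE !mnm1E !idx_eq !xpair_eqE andbT andbF /= addn0.
apply: leq_trans le_d; rewrite (bigD1 u) // [X in (_ < X)%N](bigD1 u) //= -addSn.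
apply: leq_add => [|].
  by move: lt_u; rewrite m2E mE eqxx eq_sym uNw addn0 addn1 ltnS => /subSn ->.
apply: leq_sum => t tu; move: lt_w; rewrite m2E !mE (eq_sym u t) (negPf tu) uNw !addn0.
by have [->|_] := eqVneq w t; rewrite ?addn0 // addn1 => /eqP ->.
Qed.

(** Replacing each monomial of f by one representative of its fibre changes f
    by an element of the ideal. The coefficients of the result are those of
    param f, so the result is 0. *)
Lemma ker_param f : param f = 0 -> J e f.
Proof.
move=> f0; pose s := msupp f.
pose rep mu := head 0%MM [seq m <- s | wt m == mu].
have rep_wt m : m \in s -> wt (rep (wt m)) = wt m.
  move=> ms; rewrite /rep; case E: [seq _ <- _ | _] => [|m' t] /=.
    have : m \in [seq m' <- s | wt m' == wt m] by rewrite mem_filter eqxx.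
    by rewrite E.
  have : m' \in [seq m' <- s | wt m' == wt m] by rewrite E mem_head.
  by rewrite mem_filter => /andP[/eqP].
suff E0 : \sum_(m <- s) f@_m *: 'X_[rep (wt m)] = 0 :> R.
  have -> : f = \sum_(m <- s) f@_m *: ('X_[m] - 'X_[rep (wt m)]).
    rewrite -[LHS]subr0 -[X in _ - X]E0 [X in X - _]mpolyE -sumrB.
    by apply: eq_bigr => m _; rewrite scalerBr.
  rewrite big_seq; apply: ideal_gen_sum => m /rep_wt Em; rewrite -mul_mpolyC.
  by apply/ideal_genMl/wt_fiber.
pose U := undup [seq wt m | m <- s].
transitivity (\sum_(mu <- U) (param f)@_mu *: 'X_[rep mu] : R); last first.
  by rewrite f0 big1 // => mu _; rewrite mcoeff0 scale0r.
transitivity (\sum_(m <- s) \sum_(mu <- U) (f@_m * (wt m == mu)%:R) *: 'X_[rep mu] : R).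
  rewrite !big_seq; apply: eq_bigr => m ms.
  rewrite (bigD1_seq (wt m)) ?undup_uniq ?mem_undup ?map_f //= eqxx mulr1.
  rewrite big1 ?addr0 // => mu; rewrite eq_sym => /negPf ->.
  by rewrite mulr0 scale0r.
rewrite exchange_big; apply: eq_bigr => mu _; rewrite -scaler_suml; congr (_ *: _).
rewrite {2}[f]mpolyE rmorph_sum raddf_sum; apply: eq_bigr => m _.
by rewrite -mul_mpolyC rmorphM /= paramX /param comp_mpolyC mcoeffCM mcoeffX.
Qed.

Lemma radical_complete_components : radical e.
Proof.
move=> f n /param_edge_ideal; rewrite rmorphXn => /eqP.
by rewrite expf_eq0 => /andP[_ /eqP]; apply: ker_param.
Qed.

End CompleteComponents.

(** * Radicality of binomial edge ideals *)

Theorem radical_edge_ideal e :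
  reflexive e -> ssrbool.symmetric e -> radical e.
Proof.
have [d] := ubnP #|[pred v | ~~ simplicial e v]|.
elim: d => // d IHd in e *; rewrite ltnS => le_d e_refl e_sym.
have [/existsP[v nv]|] := boolP [exists v, ~~ simplicial e v]; last first.
  rewrite negb_exists => /forallP sim; apply: radical_complete_components => //.
  by move=> v u w uv; move: u w uv => u w; rewrite e_sym; apply/simplicialP/negbNE/sim.
have decr e' : (forall w, (w == v) || simplicial e w -> simplicial e' w) ->
    (#|[pred w | ~~ simplicial e' w]| < d)%N.
  move=> sub; apply: leq_trans le_d; apply: proper_card; apply/properP; split.
    by apply/subsetP => w; rewrite !inE; apply: contra => sw; rewrite sub ?sw ?orbT.
  by exists v; rewrite !inE // sub ?eqxx.
apply: (@radical_split e v) => //; apply: IHd.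
- by apply: decr => w; apply: simplicial_delete.
- exact: delete_refl.
- exact: delete_sym.
- by apply: decr => w; apply: simplicial_complete.
- exact: complete_refl.
- exact: complete_sym.
Qed.

End BinomialEdgeIdeals.

(** * Bipartite graphs *)

Section BipartiteGraphs.
Set Implicit Arguments.
Unset Strict Implicit.
Variables (k : fieldType) (G : sgraph) (A : {set G}).
Hypothesis A_bip : forall u v : G, edge u v -> (u \in A) != (v \in A).

(** The labelling in which x_v and y_v are exchanged for v outside A. *)
Definition swap_idx (p : G * bool) : 'I_(#|G| + #|G|) :=
  if p.2 == (p.1 \in A) then lshift #|G| (enum_rank p.1)
  else rshift #|G| (enum_rank p.1).

Definition swap_own (i : 'I_(#|G| + #|G|)) : G * bool :=
  match split i with
  | inl j => (enum_val j, enum_val j \in A)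
  | inr j => (enum_val j, enum_val j \notin A)
  end.

Lemma swap_idxK : cancel swap_idx swap_own.
Proof.
case=> v b; rewrite /swap_idx /swap_own /=; case: eqP => [->|/eqP].
  by case: split_ordP => j /eqP; rewrite ?eq_shift // => /eqP <-; rewrite enum_rankK.
case: split_ordP => j /eqP; rewrite ?eq_shift // => /eqP <-; rewrite enum_rankK.
by case: b; case: (v \in A).
Qed.

Lemma swap_ownK : cancel swap_own swap_idx.
Proof.
move=> i; rewrite /swap_own /swap_idx; case: split_ordP => j -> /=.
  by rewrite eqxx enum_valK.
by case: (_ \in A); rewrite /= enum_valK.
Qed.

Definition edge_or_eq : rel G := fun u w => (u == w) || edge u w.

Lemma minor_swap (u w : G) : edge u w ->
  minor k swap_idx u w =
  (-1) ^+ (u \notin A) * (xvar k u * xvar k w - yvar k u * yvar k w).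
Proof.
move=> /A_bip; rewrite /minor /swap_idx /=.
by case: (u \in A); case: (w \in A) => //= _;
  rewrite -/(xvar k u) -/(xvar k w) -/(yvar k u) -/(yvar k w); ring.
Qed.

Lemma parity_ideal_swap f :
  parity_binomial_edge_ideal k G f <->
  ideal_gen (edge_minor swap_idx edge_or_eq) f.
Proof.
split; apply: ideal_gen_sub => _ [u [w [uw ->]]].
  rewrite -[X in ideal_gen _ X](signrMK (u \notin A)) -minor_swap //.
  by apply/ideal_genMl/minor_in; rewrite /edge_or_eq uw orbT.
have [/eqP->|{}uw] := orP uw.
  by rewrite /minor mulrC subrr; apply: ideal_gen0.
by rewrite minor_swap //; apply/ideal_genMl/ideal_gen_base; exists u, w.
Qed.

Lemma bipartite_radical : radical_ideal (parity_binomial_edge_ideal k G).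
Proof.
move=> f n /parity_ideal_swap Jfn; apply/parity_ideal_swap.
apply: (@radical_edge_ideal k _ G _ _ swap_idxK swap_ownK _ _ _ f n Jfn) => u.
  by rewrite /edge_or_eq eqxx.
by move=> w; rewrite /edge_or_eq eq_sym edge_sym.
Qed.

End BipartiteGraphs.

(** * Non-bipartite graphs *)

Section NonBipartiteGraphs.
Set Implicit Arguments.
Unset Strict Implicit.
Variables (k : fieldType) (G : sgraph) (v : G).
Local Notation R := {mpoly k[#|G| + #|G|]}.
Local Notation I := (parity_binomial_edge_ideal k G).
Local Notation x := (xvar k).
Local Notation y := (yvar k).

(** Walks from (v, false) to (w, b) in the bipartite double cover are the walks
    from v to w whose length has parity b; this makes the existence of such a
    walk decidable. *)
Definition double_cover : rel (G * bool) :=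
  fun p q => edge p.1 q.1 && (p.2 != q.2).

Definition reach (w : G) (b : bool) := connect double_cover (v, false) (w, b).

Lemma reach_step u w b : reach u b -> edge u w -> reach w (~~ b).
Proof.
move=> /connect_trans ub uw; apply: ub; apply: connect1.
by rewrite /double_cover /= uw; case: b.
Qed.

(** By connectedness every vertex is reached by a walk of some parity; when the
    parity is unique, it is a 2-colouring. *)
Lemma bipartite_of_reach : connected_graph G ->
  (forall w, ~ (reach w false /\ reach w true)) -> bipartite G.
Proof.
move=> conn excl; exists [set w | reach w false].
have reachFT w : reach w false || reach w true.
  have /connectP[p] := conn v w; elim/last_ind: p w => [|p z IHp] w.
    by move=> _ ->; rewrite /reach connect0.
  rewrite rcons_path last_rcons => /andP[/IHp/(_ erefl) lz zw] ->.
  by case/orP: lz => /reach_step/(_ zw) => ->; rewrite ?orbT.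
move=> u w uw; rewrite !inE; have := reachFT u.
have [uF _|_ /= uT] := boolP (reach u false).
  have wT := reach_step uF uw.
  by apply/eqP => /esym wF; apply: (excl w).
by rewrite (reach_step uT uw).
Qed.

(** The substitution x_w = 1 + t, y_w = 1. When 2 = 0 in k, it is modulo t^2 a
    tangent vector to the zero set of the ideal at the point with all
    coordinates 1. *)
Definition near_one : R -> {poly k} :=
  mmap polyC (fun i => if split i is inl _ then 1 + 'X else 1).

HB.instance Definition _ := GRing.RMorphism.on near_one.

Lemma near_one_x w : near_one (x w) = 1 + 'X.
Proof. by rewrite /near_one mmapX mmap1U (unsplitK (inl _)). Qed.

Lemma near_one_y w : near_one (y w) = 1.
Proof. by rewrite /near_one mmapX mmap1U (unsplitK (inr _)). Qed.

Definition unit_at_one (f : R) := (near_one f)`_0 != 0.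

Lemma unit_at_oneM f g : unit_at_one f -> unit_at_one g -> unit_at_one (f * g).
Proof. by rewrite /unit_at_one rmorphM coef0M; apply: mulf_neq0. Qed.

Lemma unit_at_one_x w : unit_at_one (x w).
Proof. by rewrite /unit_at_one near_one_x coefD coef1 coefX addr0 oner_neq0. Qed.

Lemma unit_at_one_y w : unit_at_one (y w).
Proof. by rewrite /unit_at_one near_one_y coef1 oner_neq0. Qed.

(** The contraction to R of the ideal localized at the point with all
    coordinates 1. All variables are units there. *)
Definition local_ideal (f : R) : Prop := exists2 g, unit_at_one g & I (g * f).

Lemma local_ideal_sub f : I f -> local_ideal f.
Proof.
by exists 1; rewrite ?mul1r // /unit_at_one rmorph1 coef1 oner_neq0.
Qed.

Lemma local_idealD f g : local_ideal f -> local_ideal g -> local_ideal (f + g).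
Proof.
move=> [p up Ipf] [q uq Iqg]; exists (p * q); first exact: unit_at_oneM.
rewrite (_ : _ * _ = q * (p * f) + p * (q * g)); last by ring.
by apply: ideal_genD; apply: ideal_genMl.
Qed.

Lemma local_idealMl a f : local_ideal f -> local_ideal (a * f).
Proof.
by move=> [p up Ipf]; exists p => //; rewrite mulrCA; apply: ideal_genMl.
Qed.

Lemma local_ideal_cancel g f : unit_at_one g -> local_ideal (g * f) -> local_ideal f.
Proof.
by move=> ug [p up]; rewrite mulrA; exists (p * g) => //; apply: unit_at_oneM.
Qed.

Definition var (w : G) (b : bool) : R := if b then y w else x w.

(** Near the point with all coordinates 1, an edge forces
    x_w / y_w = y_u / x_u; so along a walk the ratio x / y is kept when its
    length is even and inverted when it is odd. *)
Lemma reach_local w b : reach w b ->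
  local_ideal (x v * var w (~~ b) - y v * var w b).
Proof.
case/connectP=> p; elim/last_ind: p w b => [|p [u c] IHp] w b.
  move=> _ [-> ->] /=; rewrite mulrC subrr.
  exact/local_ideal_sub/ideal_gen0.
rewrite rcons_path last_rcons => /andP[/IHp{IHp}]; case: (last _ _) => z d.
move=> /(_ _ _ erefl) Iz /andP[/= zu dc] [-> ->] {w b}.
have {dc} -> : c = ~~ d by move: dc; case: (c); case: (d).
have Izu : local_ideal (x z * x u - y z * y u).
  by apply/local_ideal_sub/ideal_gen_base; exists z, u.
apply: (@local_ideal_cancel (var z (~~ d))).
  by case: (d); [apply: unit_at_one_x | apply: unit_at_one_y].
rewrite (_ : _ * _ = var u d * (x v * var z (~~ d) - y v * var z d)
    + (-1) ^+ d * y v * (x z * x u - y z * y u)).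
  by apply: local_idealD; apply: local_idealMl.
by case: (d); rewrite /var /=; ring.
Qed.

(** Walks of both parities from v to w give x_v / y_v = y_v / x_v. *)
Lemma odd_walk_local w : reach w false -> reach w true ->
  local_ideal (x v ^+ 2 - y v ^+ 2).
Proof.
move=> /reach_local /= IF /reach_local /= IT.
apply: (@local_ideal_cancel (x w)); first exact: unit_at_one_x.
rewrite (_ : _ * _ = x v * (x v * x w - y v * y w) + y v * (x v * y w - y v * x w)).
  by apply: local_idealD; apply: local_idealMl.
by ring.
Qed.

Hypothesis char_k : 2%N \in [pchar k].

Lemma pchar2_poly : 2%:R = 0 :> {poly k}.
Proof. by rewrite -polyC_natr (pcharf0 char_k). Qed.

Lemma pchar2_mpoly : 2%:R = 0 :> R.
Proof. by rewrite -mpolyC_nat (pcharf0 char_k) mpolyC0. Qed.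

(** In characteristic 2 every edge binomial becomes (1 + t)^2 - 1 = t^2. *)
Lemma near_one_ideal f : I f -> (near_one f)`_1 = 0.
Proof.
suff E : I f -> exists q, near_one f = q * 'X^2 by case/E => q ->; rewrite coefMXn.
move: f; apply: ideal_gen_ind => [|f g [q Ef] [r Eg]|a _ [u [w [uw ->]]]].
- by exists 0; rewrite rmorph0 mul0r.
- by exists (q + r); rewrite rmorphD /= Ef Eg mulrDl.
exists (near_one a); rewrite rmorphM; congr (_ * _).
rewrite rmorphB !rmorphM /= !near_one_x !near_one_y.
transitivity ('X^2 + 2%:R * 'X : {poly k}); first by ring.
by rewrite pchar2_poly mul0r addr0.
Qed.

(** The square of g (x_v - y_v) lies in the ideal, but its image under near_one
    is t times a polynomial with nonzero constant coefficient. *)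
Lemma radical_no_odd_walk w : radical_ideal I -> ~ (reach w false /\ reach w true).
Proof.
move=> rad [wF wT]; have [g ug Ig] := odd_walk_local wF wT.
have /near_one_ideal : I (g * (x v - y v)).
  apply: (rad _ 2%N); rewrite (_ : _ ^+ 2 = g * (g * (x v ^+ 2 - y v ^+ 2))).
    exact: ideal_genMl.
  transitivity (g * (g * (x v ^+ 2 - y v ^+ 2)) - 2%:R * (g ^+ 2 * y v * (x v - y v))).
    by ring.
  by rewrite pchar2_mpoly mul0r subr0.
rewrite rmorphM rmorphB /= near_one_x near_one_y addrAC subrr add0r coefMX /=.
by move/eqP; apply/negP.
Qed.

End NonBipartiteGraphs.

(** * Radicality of the parity binomial edge ideal *)

Theorem mainTheorem2 (k : fieldType) (char_k : 2%N \in [pchar k])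
    (G : sgraph) (conn_G : connected_graph G) :
  radical_ideal (parity_binomial_edge_ideal k G) <-> bipartite G.
Proof.
split=> [rad|[A A_bip]]; last exact: bipartite_radical A_bip.
have [v _|G0] := pickP [pred v : G | true].
  apply: (bipartite_of_reach (v := v) conn_G) => w; exact: radical_no_odd_walk char_k w rad.
by exists set0 => u; have := G0 u.
Qed.
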